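(* The logic $\mathcal L(2^e)$ corresponding to the variety $\mathbb V(\mathbf{2^e})$ is defined, as an axiomatic extension of the logic $\mathcal L(2^e,\bar 2^e)$, by the axiom $\bot\to\top$.
   Context: Language: $\langle\vee,\wedge,\to,\sim,\bot,\top\rangle$ of arities $2,2,2,1,0,0$. $\alpha\to_H\beta$ abbreviates $\alpha\to(\alpha\wedge\beta)$. The logic $\mathcal{DHMSH}$ is the Hilbert-style logic with axiom schemes: (A1) $\alpha\to_H(\alpha\vee\beta)$; (A2) $\beta\to_H(\alpha\vee\beta)$; (A3) $(\alpha\to_H\gamma)\to_H[(\beta\to_H\gamma)\to_H((\alpha\vee\beta)\to_H\gamma)]$; (A4) $(\alpha\wedge\beta)\to_H\alpha$; (A5) $(\gamma\to_H\alpha)\to_H[(\gamma\to_H\beta)\to_H(\gamma\to_H(\alpha\wedge\beta))]$; (A6) $\top$; (A7) $\bot\to_H\alpha$; (A8) $((\alpha\wedge\beta)\to_H\gamma)\to_H(\alpha\to_H(\beta\to_H\gamma))$; (A9) $(\alpha\to_H(\beta\to_H\gamma))\to_H((\alpha\wedge\beta)\to_H\gamma)$; (A10) $(\alpha\to_H\beta)\to_H((\beta\to_H\alpha)\to_H((\alpha\to\gamma)\to_H(\beta\to\gamma)))$; (A11) $(\alpha\to_H\beta)\to_H((\beta\to_H\alpha)\to_H((\gamma\to\beta)\to_H(\gamma\to\alpha)))$; (A12) $\top\to_H{\sim}\bot$; (A13) ${\sim}\top\to_H\bot$; (A14) ${\sim}(\alpha\wedge\beta)\to_H({\sim}\alpha\vee{\sim}\beta)$;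 and rules (SMP): from $\phi$ and $\phi\to_H\gamma$ deduce $\gamma$; (SCP): from $\phi\to_H\gamma$ deduce ${\sim}\gamma\to_H{\sim}\phi$ (both applicable to any formulas derived from the premises). An axiomatic extension is obtained by adjoining new axiom schemes and keeping the same rules. A semi-Heyting algebra is an algebra $\langle L,\vee,\wedge,\to,0,1\rangle$ such that $\langle L,\vee,\wedge,0,1\rangle$ is a lattice with $0$ and $1$, and $x\wedge(x\to y)\approx x\wedge y$, $x\wedge(y\to z)\approx x\wedge[(x\wedge y)\to(x\wedge z)]$, $x\to x\approx1$. $\mathbb{DHMSH}$ is the variety of algebras $\langle A,\vee,\wedge,\to,{}',0,1\rangle$ such that $\langle A,\vee,\wedge,\to,0,1\rangle$ is a semi-Heyting algebra and $0'\approx1$, $1'\approx0$, $(x\wedge y)'\approx x'\vee y'$. Formulas are interpreted with $\sim,\bot,\top$ as ${}',0,1$. The logic corresponding to a subvariety $\mathbb V$ of $\mathbb{DHMSH}$ is the unique axiomatic extension $\mathcal E$ of $\mathcal{DHMSH}$ such that $\mathbb V=\{\mathbf A\in\mathbb{DHMSH}:\mathbf A\models\delta\approx1\text{ for every theorem }\delta\text{ of }\mathcal E\}$; $\mathbb V$ is then the equivalent algebraic semantics of $\mathcal E$. $\mathbf{2^e}$ and $\mathbf{\bar 2^e}$ are the algebras on the two-element lattice $0<1$ with $0'=1$, $1'=0$; in $\mathbf{2^e}$: $0\to0=0\to1=1\to1=1$, $1\to0=0$; in $\mathbf{\bar 2^e}$: $0\to0=1\to1=1$, $0\to1=1\to0=0$.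 $\mathbb V(\cdot)$ denotes the generated variety. $\mathcal L(2^e,\bar 2^e)$ is the logic corresponding to $\mathbb V(\mathbf{2^e},\mathbf{\bar 2^e})$. *)

(* Defs.v *)
From Stdlib Require Import Bool ClassicalEpsilon.

Set Implicit Arguments.
Unset Strict Implicit.
Unset Printing Implicit Defensive.

(** * Algebras of type (2,2,2,1,0,0) and varieties *)

Record algebra : Type := Algebra {
  carrier :> Type;
  join : carrier -> carrier -> carrier;
  meet : carrier -> carrier -> carrier;
  imp  : carrier -> carrier -> carrier;
  neg  : carrier -> carrier;
  zero : carrier;
  one  : carrier
}.

Arguments zero {a}.
Arguments one {a}.

Record hom (A B : algebra) (h : A -> B) : Prop := {
  hom_join : forall x y, h (join x y) = join (h x) (h y);
  hom_meet : forall x y, h (meet x y) = meet (h x) (h y);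
  hom_imp  : forall x y, h (imp x y) = imp (h x) (h y);
  hom_neg  : forall x, h (neg x) = neg (h x);
  hom_zero : h zero = zero;
  hom_one  : h one = one
}.

Definition product (I : Type) (A : I -> algebra) : algebra := {|
  carrier := forall i, A i;
  join := fun x y i => join (x i) (y i);
  meet := fun x y i => meet (x i) (y i);
  imp  := fun x y i => imp (x i) (y i);
  neg  := fun x i => neg (x i);
  zero := fun i => zero;
  one  := fun i => one
|}.

(** Subalgebras are taken up to isomorphism, as injective homomorphisms. *)
Record variety (W : algebra -> Prop) : Prop := {
  variety_H : forall (A B : algebra) (h : A -> B),
    hom h -> (forall b, exists a, h a = b) -> W A -> W B;
  variety_S : forall (A B : algebra) (h : B -> A),
    hom h -> (forall x y, h x = h y -> x = y) -> W A -> W B;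
  variety_P : forall (I : Type) (A : I -> algebra),
    (forall i, W (A i)) -> W (product A)
}.

Definition generated_variety (K : algebra -> Prop) (A : algebra) : Prop :=
  forall W : algebra -> Prop,
    variety W -> (forall B, K B -> W B) -> W A.

(** * Dually hemimorphic semi-Heyting algebras *)

Record bounded_lattice (A : algebra) : Prop := {
  joinC : forall x y : A, join x y = join y x;
  meetC : forall x y : A, meet x y = meet y x;
  joinA : forall x y z : A, join x (join y z) = join (join x y) z;
  meetA : forall x y z : A, meet x (meet y z) = meet (meet x y) z;
  joinK : forall x y : A, join x (meet x y) = x;
  meetK : forall x y : A, meet x (join x y) = x;
  join0 : forall x : A, join x zero = x;
  meet1 : forall x : A, meet x one = x
}.

Record semi_heyting (A : algebra) : Prop := {
  sh_lattice : bounded_lattice A;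
  sh_mp : forall x y : A, meet x (imp x y) = meet x y;
  sh_rel : forall x y z : A,
    meet x (imp y z) = meet x (imp (meet x y) (meet x z));
  sh_refl : forall x : A, imp x x = one
}.

Record dhmsh_algebra (A : algebra) : Prop := {
  dhmsh_sh : semi_heyting A;
  dhmsh_neg0 : neg (@zero A) = one;
  dhmsh_neg1 : neg (@one A) = zero;
  dhmsh_neg_meet : forall x y : A, neg (meet x y) = join (neg x) (neg y)
}.

(** The two-element lattice is [bool] with [false < true]; [implb false true]
    is [true], whereas [eqb false true] is [false]. *)
Definition two_e : algebra := Algebra orb andb implb negb false true.
Definition two_bar_e : algebra := Algebra orb andb eqb negb false true.

(** * Formulas and Hilbert-style logics *)

Inductive form : Type :=
| Var (n : nat)
| Or (a b : form)
| And (a b : form)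
| Imp (a b : form)
| Neg (a : form)
| Bot
| Top.

Definition ImpH (a b : form) : form := Imp a (And a b).

Fixpoint subst (s : nat -> form) (f : form) : form :=
  match f with
  | Var n => s n
  | Or a b => Or (subst s a) (subst s b)
  | And a b => And (subst s a) (subst s b)
  | Imp a b => Imp (subst s a) (subst s b)
  | Neg a => Neg (subst s a)
  | Bot => Bot
  | Top => Top
  end.

Fixpoint eval (A : algebra) (v : nat -> A) (f : form) : A :=
  match f with
  | Var n => v n
  | Or a b => join (eval v a) (eval v b)
  | And a b => meet (eval v a) (eval v b)
  | Imp a b => imp (eval v a) (eval v b)
  | Neg a => neg (eval v a)
  | Bot => zero
  | Top => one
  end.

Definition valid (A : algebra) (f : form) : Prop :=
  forall v : nat -> A, eval v f = one.

(** A logic is its consequence relation. *)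
Definition logic : Type := (form -> Prop) -> form -> Prop.

(** [hilbert Ax] is the logic with axiom schemes [Ax]: the variables of a scheme
    are metavariables, so every substitution instance is an axiom.  Both rules
    apply to arbitrary formulas derived from the premises [G]. *)
Inductive hilbert (Ax : form -> Prop) (G : form -> Prop) : form -> Prop :=
| hilbert_axiom : forall (s : nat -> form) a, Ax a -> hilbert Ax G (subst s a)
| hilbert_premise : forall a, G a -> hilbert Ax G a
| hilbert_SMP : forall a c,
    hilbert Ax G a -> hilbert Ax G (ImpH a c) -> hilbert Ax G c
| hilbert_SCP : forall a c,
    hilbert Ax G (ImpH a c) -> hilbert Ax G (ImpH (Neg c) (Neg a)).

Definition is_theorem (L : logic) (a : form) : Prop := L (fun _ => False) a.

Inductive dhmsh_axiom : form -> Prop :=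
| A1 a b : dhmsh_axiom (ImpH a (Or a b))
| A2 a b : dhmsh_axiom (ImpH b (Or a b))
| A3 a b c : dhmsh_axiom
    (ImpH (ImpH a c) (ImpH (ImpH b c) (ImpH (Or a b) c)))
| A4 a b : dhmsh_axiom (ImpH (And a b) a)
| A5 a b c : dhmsh_axiom
    (ImpH (ImpH c a) (ImpH (ImpH c b) (ImpH c (And a b))))
| A6 : dhmsh_axiom Top
| A7 a : dhmsh_axiom (ImpH Bot a)
| A8 a b c : dhmsh_axiom
    (ImpH (ImpH (And a b) c) (ImpH a (ImpH b c)))
| A9 a b c : dhmsh_axiom
    (ImpH (ImpH a (ImpH b c)) (ImpH (And a b) c))
| A10 a b c : dhmsh_axiom
    (ImpH (ImpH a b) (ImpH (ImpH b a) (ImpH (Imp a c) (Imp b c))))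
| A11 a b c : dhmsh_axiom
    (ImpH (ImpH a b) (ImpH (ImpH b a) (ImpH (Imp c b) (Imp c a))))
| A12 : dhmsh_axiom (ImpH Top (Neg Bot))
| A13 : dhmsh_axiom (ImpH (Neg Top) Bot)
| A14 a b : dhmsh_axiom (ImpH (Neg (And a b)) (Or (Neg a) (Neg b))).

Definition DHMSH : logic := hilbert dhmsh_axiom.

(** [E] is obtained from [L] by adjoining the schemes [S] to the axioms of [L].
    The choice of the axioms [Ax] presenting [L] is immaterial. *)
Definition axiomatic_extension (L : logic) (S : form -> Prop) (E : logic) : Prop :=
  exists Ax : form -> Prop,
    L = hilbert Ax /\ E = hilbert (fun a => Ax a \/ S a).

Definition corresponds (V : algebra -> Prop) (E : logic) : Prop :=
  (exists S, axiomatic_extension DHMSH S E) /\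
  forall A : algebra,
    V A <-> dhmsh_algebra A /\ forall d, is_theorem E d -> valid A d.

(** The logic corresponding to [V]; for every subvariety [V] of the variety of
    [dhmsh_algebra]s there is exactly one [E] with [corresponds V E], and only
    then is this meaningful. *)
Definition logic_of (V : algebra -> Prop) : logic :=
  epsilon (inhabits DHMSH) (corresponds V).

Definition L_two_e : logic :=
  logic_of (generated_variety (fun A => A = two_e)).

Definition L_two_e_two_bar_e : logic :=
  logic_of (generated_variety (fun A => A = two_e \/ A = two_bar_e)).

(* Main.v *)
From Stdlib Require Import Bool ClassicalEpsilon List.
From Stdlib Require Import FunctionalExtensionality PropExtensionality ProofIrrelevance.
Require Import Defs.
Import ListNotations.

Set Implicit Arguments.
Unset Strict Implicit.
Unset Printing Implicit Defensive.

(** Let [K1] be the class of [two_e], [K2] that of [two_e] and [two_bar_e], and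
    let [T1], [T2] be the sets of formulas valid in them.  For either class,
    the logic corresponding to the generated variety is
    [hilbert (dhmsh_axiom \/ T)], where [T] is the set of valid formulas
    ([logic_of_generated]).

    Granting this, the corollary rests on one observation: if [f] is in [T1],
    then [(Bot -> Top) ->H f] is in [T2].  It holds in [two_e] because [f]
    does, and in [two_bar_e] because [Bot -> Top] takes the value [0] there
    and [0 ->H x] is always [1].
    So [f] follows by (SMP) from an axiom of the weaker logic and [Bot -> Top],
    while [Bot -> Top] itself is in [T1].

    The description of the corresponding logics has two halves.  Uniqueness is
    algebraic completeness: the Lindenbaum algebra of an axiomatic extension
    is a [dhmsh_algebra] ([dhmsh_lindenbaum]), so it lies in the variety, and
    the theorems of the logic are exactly the formulas valid in the variety
    ([theorem_iff_valid]); two Hilbert systems with the same theorems are equal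
    because their rules are the same.  Existence is Birkhoff's theorem for a
    set of algebras ([generated_of_models]): an algebra satisfying all
    identities of [K] is a homomorphic image of a subalgebra of a product of
    members of [K].  Soundness is needed for the two-element algebras only, where it is a
    matter of truth tables. *)

(** * Deduction in DHMSH *)

(** Sets of formulas containing the axioms of DHMSH and closed under its rules. *)
Record dhmsh_theory (T : form -> Prop) : Prop := {
  th_ax : forall a, dhmsh_axiom a -> T a;
  th_mp : forall a c, T a -> T (ImpH a c) -> T c;
  th_cp : forall a c, T (ImpH a c) -> T (ImpH (Neg c) (Neg a))
}.

Section Deduction.

Variable T : form -> Prop.
Hypothesis HT : dhmsh_theory T.

Local Notation "a =< b" := (T (ImpH a b)) (at level 70).

Lemma mp_le a b : a =< b -> T a -> T b.
Proof. intros H Ha; exact (th_mp HT Ha H). Qed.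

Lemma le_curry a b c : And a b =< c -> a =< ImpH b c.
Proof. apply mp_le, (th_ax HT), A8. Qed.

Lemma le_uncurry a b c : a =< ImpH b c -> And a b =< c.
Proof. apply mp_le, (th_ax HT), A9. Qed.

Lemma le_meet_l a b : And a b =< a.
Proof. apply (th_ax HT), A4. Qed.

Lemma le_weaken a b : T b -> a =< b.
Proof. apply mp_le, le_curry, le_meet_l. Qed.

Lemma le_meet c a b : c =< a -> c =< b -> c =< And a b.
Proof.
intros Ha; apply mp_le; revert Ha; apply mp_le.
apply (th_ax HT), A5.
Qed.

Lemma le_drop a b c : b =< c -> And a b =< c.
Proof. intros H; apply le_uncurry, le_weaken, H. Qed.

(** Replacement of equivalents on either side of an implication which is a
    theorem. *)
Lemma imp_replace_l a b c : a =< b -> b =< a -> T (Imp a c) -> T (Imp b c).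
Proof.
intros Hab Hba; apply mp_le; revert Hba; apply mp_le; revert Hab; apply mp_le.
apply (th_ax HT), A10.
Qed.

Lemma imp_replace_r a b c : a =< b -> b =< a -> T (Imp c b) -> T (Imp c a).
Proof.
intros Hab Hba; apply mp_le; revert Hba; apply mp_le; revert Hab; apply mp_le.
apply (th_ax HT), A11.
Qed.

(** (A1) is the formula [a -> (a /\ (a \/ a))], and [a /\ (a \/ a)] can be
    replaced by [a /\ a] without knowing that [=<] is reflexive or transitive. *)
Lemma le_refl a : a =< a.
Proof.
assert (A1a : a =< Or a a) by apply (th_ax HT), A1.
apply (@imp_replace_r (And a a) (And a (Or a a)) a); [ | | exact A1a].
- apply le_meet; [apply le_meet_l | apply le_drop, A1a].
- apply le_meet; apply le_meet_l.
Qed.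

Lemma le_meet_r a b : And a b =< b.
Proof. apply le_drop, le_refl. Qed.

Lemma le_meetC a b : And a b =< And b a.
Proof. apply le_meet; [apply le_meet_r | apply le_meet_l]. Qed.

(** Transitivity of [=<] is reached through replacement of equivalents, on the
    right and then on the left of [=<]. *)
Lemma le_replace_r p u w : u =< w -> w =< u -> p =< u -> p =< w.
Proof.
intros Huw Hwu.
apply imp_replace_r; (apply le_meet; [apply le_meet_l | apply le_drop]); assumption.
Qed.

Lemma le_meet_congr_l u w q : u =< w -> w =< u -> And u q =< And w q.
Proof.
intros Huw Hwu; apply le_meet; [ | apply le_meet_r].
apply (@le_replace_r _ u w Huw Hwu), le_meet_l.
Qed.

Lemma le_replace_l u w x : u =< w -> w =< u -> u =< x -> w =< x.
Proof.
intros Huw Hwu Hux.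
apply (@imp_replace_r (And w x) (And u x)); try (apply le_meet_congr_l; assumption).
exact (imp_replace_l Huw Hwu Hux).
Qed.

Lemma le_trans b a c : a =< b -> b =< c -> a =< c.
Proof.
intros Hab Hbc; apply (@le_replace_l (And a b)).
- apply le_meet_l.
- apply le_meet; [apply le_refl | exact Hab].
- apply le_drop, Hbc.
Qed.

Lemma le_join_l a b : a =< Or a b.
Proof. apply (th_ax HT), A1. Qed.

Lemma le_join_r a b : b =< Or a b.
Proof. apply (th_ax HT), A2. Qed.

Lemma le_join a b c : a =< c -> b =< c -> Or a b =< c.
Proof.
intros Ha; apply mp_le; revert Ha; apply mp_le.
apply (th_ax HT), A3.
Qed.

Lemma le_impH_mp a b : And a (ImpH a b) =< b.
Proof.
apply le_trans with (And (ImpH a b) a); [apply le_meetC|].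
apply le_uncurry, le_refl.
Qed.

(** Congruence of [Imp] relative to a hypothesis [z]. *)
Lemma le_imp_congr_l z a b c :
  And z a =< b -> And z b =< a -> And z (Imp a c) =< Imp b c.
Proof.
intros Hab Hba; apply le_uncurry.
apply le_trans with (And (ImpH a b) (ImpH b a)).
- apply le_meet; apply le_curry; assumption.
- apply le_uncurry, (th_ax HT), A10.
Qed.

Lemma le_imp_congr_r z a b c :
  And z a =< b -> And z b =< a -> And z (Imp c b) =< Imp c a.
Proof.
intros Hab Hba; apply le_uncurry.
apply le_trans with (And (ImpH a b) (ImpH b a)).
- apply le_meet; apply le_curry; assumption.
- apply le_uncurry, (th_ax HT), A11.
Qed.

Lemma le_imp_congr a a' b b' :
  a =< a' -> a' =< a -> b =< b' -> b' =< b -> Imp a b =< Imp a' b'.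
Proof.
intros H1 H2 H3 H4; apply le_trans with (Imp a' b).
- apply (th_mp HT H2), (th_mp HT H1), (th_ax HT), A10.
- apply (th_mp HT H3), (th_mp HT H4), (th_ax HT), A11.
Qed.

(** * The Lindenbaum algebra *)

Definition equiv (a b : form) : Prop := a =< b /\ b =< a.

(** A representative of the class of [a], depending on that class only. *)
Definition canon (a : form) : form := epsilon (inhabits Bot) (equiv a).

Lemma canon_equiv a : equiv a (canon a).
Proof.
unfold canon; apply epsilon_spec.
exists a; split; apply le_refl.
Qed.

Lemma canon_eq a b : equiv a b -> canon a = canon b.
Proof.
intros [Hab Hba]; unfold canon; f_equal.
apply functional_extensionality; intros c; apply propositional_extensionality.
split; intros [H1 H2]; split; eauto using le_trans.
Qed.

Lemma canonK a : canon (canon a) = canon a.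
Proof. symmetry; apply canon_eq, canon_equiv. Qed.

(** The quotient of the formulas by [equiv], as the set of representatives. *)
Definition classes : Type := {a : form | canon a = a}.

Definition cls (a : form) : classes := exist _ (canon a) (canonK a).

Definition lindenbaum : algebra := {|
  carrier := classes;
  join := fun x y => cls (Or (proj1_sig x) (proj1_sig y));
  meet := fun x y => cls (And (proj1_sig x) (proj1_sig y));
  imp  := fun x y => cls (Imp (proj1_sig x) (proj1_sig y));
  neg  := fun x => cls (Neg (proj1_sig x));
  zero := cls Bot;
  one  := cls Top
|}.

Lemma cls_eq a b : a =< b -> b =< a -> cls a = cls b.
Proof. intros Hab Hba; apply subset_eq_compat, canon_eq; split; assumption. Qed.

Lemma cls_inj a b : cls a = cls b -> equiv a b.
Proof.
intros H; apply (f_equal (@proj1_sig _ _)) in H; simpl in H.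
destruct (canon_equiv a) as [H1 H2], (canon_equiv b) as [H3 H4].
rewrite H in H1, H2; split; eauto using le_trans.
Qed.

Lemma clsK (x : classes) : cls (proj1_sig x) = x.
Proof. destruct x as [a Ha]; apply subset_eq_compat, Ha. Qed.

Lemma cls_join a b : @join lindenbaum (cls a) (cls b) = cls (Or a b).
Proof.
destruct (canon_equiv a), (canon_equiv b); apply cls_eq;
  apply le_join; eauto using le_trans, le_join_l, le_join_r.
Qed.

Lemma cls_meet a b : @meet lindenbaum (cls a) (cls b) = cls (And a b).
Proof.
destruct (canon_equiv a), (canon_equiv b); apply cls_eq;
  apply le_meet; eauto using le_trans, le_meet_l, le_meet_r.
Qed.

Lemma cls_imp a b : @imp lindenbaum (cls a) (cls b) = cls (Imp a b).
Proof.
destruct (canon_equiv a), (canon_equiv b); apply cls_eq;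
  apply le_imp_congr; assumption.
Qed.

Lemma cls_neg a : @neg lindenbaum (cls a) = cls (Neg a).
Proof.
destruct (canon_equiv a); apply cls_eq; apply (th_cp HT); assumption.
Qed.

Lemma cls_one a : cls a = cls Top <-> T a.
Proof.
split; intros H.
- apply cls_inj in H; destruct H as [_ H].
  apply (mp_le H), (th_ax HT), A6.
- apply cls_eq; apply le_weaken; [apply (th_ax HT), A6 | exact H].
Qed.

Lemma bounded_lattice_lindenbaum : bounded_lattice lindenbaum.
Proof.
split;
  repeat (let x := fresh in intros x; rewrite <- (clsK x); generalize (proj1_sig x);
          clear x; intros x);
  change (@zero lindenbaum) with (cls Bot); change (@one lindenbaum) with (cls Top);
  rewrite ?cls_join, ?cls_meet, ?cls_join, ?cls_meet; apply cls_eq;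
  repeat (apply le_join || apply le_meet);
  eauto using le_trans, le_refl, le_join_l, le_join_r, le_meet_l, le_meet_r.
- apply (th_ax HT), A7.
- apply le_weaken, (th_ax HT), A6.
Qed.

Lemma le_sh_mp a b : And a (Imp a b) =< b.
Proof.
apply le_trans with (And a (ImpH a b)); [|apply le_impH_mp].
apply le_meet; [apply le_meet_l|].
(* Under the hypothesis [a], [b] may be replaced by [And a b]. *)
apply le_imp_congr_r; [|apply le_meet]; eauto using le_trans, le_meet_l, le_meet_r.
Qed.

Lemma le_sh_mp_conv a b : And a b =< Imp a b.
Proof.
apply le_trans with (And a (ImpH a b)).
- apply le_meet; [apply le_meet_l|].
  apply le_drop, le_curry, le_meet_l.
- apply le_imp_congr_r; [apply le_meet|]; eauto using le_trans, le_meet_l, le_meet_r.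
Qed.

Lemma le_sh_rel a b c : And a (Imp b c) =< Imp (And a b) (And a c).
Proof.
apply le_trans with (And a (Imp (And a b) c)).
- apply le_meet; [apply le_meet_l|].
  apply le_imp_congr_l; [apply le_refl | apply le_drop, le_meet_r].
- apply le_imp_congr_r; [apply le_drop, le_meet_r | apply le_refl].
Qed.

Lemma le_sh_rel_conv a b c : And a (Imp (And a b) (And a c)) =< Imp b c.
Proof.
apply le_trans with (And a (Imp b (And a c))).
- apply le_meet; [apply le_meet_l|].
  apply le_imp_congr_l; [apply le_drop, le_meet_r | apply le_refl].
- apply le_imp_congr_r; [apply le_refl | apply le_drop, le_meet_r].
Qed.

Lemma imp_refl a : T (Imp a a).
Proof.
apply (@imp_replace_r a (And a a)); [ | apply le_meet_l | apply le_refl].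
apply le_meet; apply le_refl.
Qed.

Lemma semi_heyting_lindenbaum : semi_heyting lindenbaum.
Proof.
split; [apply bounded_lattice_lindenbaum | | | ].
- intros x y; rewrite <- (clsK x), <- (clsK y), cls_imp, !cls_meet.
  apply cls_eq; (apply le_meet; [apply le_meet_l|]);
    [apply le_sh_mp | apply le_sh_mp_conv].
- intros x y z; rewrite <- (clsK x), <- (clsK y), <- (clsK z).
  rewrite !cls_meet, !cls_imp, !cls_meet.
  apply cls_eq; (apply le_meet; [apply le_meet_l|]);
    [apply le_sh_rel | apply le_sh_rel_conv].
- intros x; rewrite <- (clsK x), cls_imp; apply cls_one, imp_refl.
Qed.

Lemma dhmsh_lindenbaum : dhmsh_algebra lindenbaum.
Proof.
split; [apply semi_heyting_lindenbaum | | | ].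
- change (@zero lindenbaum) with (cls Bot); rewrite cls_neg; apply cls_one.
  apply (th_mp HT (th_ax HT A6)), (th_ax HT), A12.
- change (@one lindenbaum) with (cls Top); rewrite cls_neg.
  apply cls_eq; apply (th_ax HT); [apply A13 | apply A7].
- intros x y; rewrite <- (clsK x), <- (clsK y).
  rewrite cls_meet, !cls_neg, cls_join.
  apply cls_eq; [apply (th_ax HT), A14|].
  apply le_join; apply (th_cp HT); [apply le_meet_l | apply le_meet_r].
Qed.

Lemma eval_lindenbaum (v : nat -> lindenbaum) f :
  eval v f = cls (subst (fun n => proj1_sig (v n)) f).
Proof.
induction f as [n|a IHa b IHb|a IHa b IHb|a IHa b IHb|a IHa| |]; cbn [eval subst].
- symmetry; apply clsK.
- rewrite IHa, IHb; apply cls_join.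
- rewrite IHa, IHb; apply cls_meet.
- rewrite IHa, IHb; apply cls_imp.
- rewrite IHa; apply cls_neg.
- reflexivity.
- reflexivity.
Qed.

Lemma eval_lindenbaum_cls f : @eval lindenbaum (fun n => cls (Var n)) f = cls f.
Proof.
induction f as [n|a IHa b IHb|a IHa b IHb|a IHa b IHb|a IHa| |]; cbn [eval];
  rewrite ?IHa, ?IHb; auto using cls_join, cls_meet, cls_imp, cls_neg.
Qed.

Lemma valid_lindenbaum :
  (forall s a, T a -> T (subst s a)) -> forall f, valid lindenbaum f <-> T f.
Proof.
intros Hsubst f; split.
- intros H; apply cls_one; rewrite <- eval_lindenbaum_cls; apply H.
- intros H v; rewrite eval_lindenbaum; apply cls_one, Hsubst, H.
Qed.

End Deduction.

(** * Hilbert systems and their theorems *)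

Lemma subst_subst s s' f : subst s (subst s' f) = subst (fun n => subst s (s' n)) f.
Proof. induction f; simpl; congruence. Qed.

Lemma subst_Var f : subst Var f = f.
Proof. induction f; simpl; congruence. Qed.

Lemma hilbert_ax (Ax G : form -> Prop) a : Ax a -> hilbert Ax G a.
Proof. intros H; rewrite <- (subst_Var a); apply hilbert_axiom, H. Qed.

(** If every instance of [Ax] is a theorem of [Ax'], then [Ax'] is stronger. *)
Lemma hilbert_le (Ax Ax' G : form -> Prop) f :
  (forall s a, Ax a -> is_theorem (hilbert Ax') (subst s a)) ->
  hilbert Ax G f -> hilbert Ax' G f.
Proof.
intros HAx H; induction H as [s a Ha|a Ha|a c _ IHa _ IHc|a c _ IH].
- specialize (HAx s a Ha); unfold is_theorem in HAx.
  induction HAx as [s' b Hb|b []|b c _ IHb _ IHc|b c _ IHb].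
  + apply hilbert_axiom, Hb.
  + exact (hilbert_SMP IHb IHc).
  + exact (hilbert_SCP IHb).
- apply hilbert_premise, Ha.
- exact (hilbert_SMP IHa IHc).
- exact (hilbert_SCP IH).
Qed.

Lemma hilbert_eq (Ax Ax' : form -> Prop) :
  (forall s a, Ax a -> is_theorem (hilbert Ax') (subst s a)) ->
  (forall s a, Ax' a -> is_theorem (hilbert Ax) (subst s a)) ->
  hilbert Ax = hilbert Ax'.
Proof.
intros H H'.
apply functional_extensionality; intros G; apply functional_extensionality; intros f.
apply propositional_extensionality; split; apply hilbert_le; assumption.
Qed.

Lemma theorem_subst Ax s f :
  is_theorem (hilbert Ax) f -> is_theorem (hilbert Ax) (subst s f).
Proof.
unfold is_theorem; intros H; induction H as [s' a Ha|a []|a c _ IHa _ IHc|a c _ IH].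
- rewrite subst_subst; apply hilbert_axiom, Ha.
- exact (hilbert_SMP IHa IHc).
- exact (hilbert_SCP IH).
Qed.

Lemma dhmsh_theory_theorems S E :
  axiomatic_extension DHMSH S E -> dhmsh_theory (is_theorem E).
Proof.
intros [Ax [HAx ->]]; split.
- intros a Ha; apply (@hilbert_le Ax).
  + intros s b Hb; apply hilbert_axiom; left; exact Hb.
  + rewrite <- HAx; apply hilbert_ax, Ha.
- intros a c; apply hilbert_SMP.
- intros a c; apply hilbert_SCP.
Qed.

(** Algebraic completeness: the Lindenbaum algebra of [E] lies in [V]. *)
Lemma theorem_iff_valid V E :
  corresponds V E -> forall f, is_theorem E f <-> forall A, V A -> valid A f.
Proof.
intros [[S HS] HV] f; split.
- intros Hf A HA; apply HV in HA; apply HA, Hf.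
- intros Hf; pose proof (dhmsh_theory_theorems HS) as HT.
  assert (Hsubst : forall s a, is_theorem E a -> is_theorem E (subst s a)).
  { destruct HS as [Ax [_ ->]]; intros s a; apply theorem_subst. }
  apply (proj1 (valid_lindenbaum HT Hsubst f)), Hf, (proj2 (HV _)); split.
  + apply dhmsh_lindenbaum.
  + intros d Hd; apply (valid_lindenbaum HT Hsubst), Hd.
Qed.

Lemma corresponds_unique V E E' : corresponds V E -> corresponds V E' -> E = E'.
Proof.
intros HE HE'.
pose proof (theorem_iff_valid HE) as Hth; pose proof (theorem_iff_valid HE') as Hth'.
destruct HE as [[S [Ax [_ ->]]] _], HE' as [[S' [Ax' [_ ->]]] _].
apply hilbert_eq; intros s a Ha.
- apply Hth', Hth, hilbert_axiom, Ha.
- apply Hth, Hth', hilbert_axiom, Ha.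
Qed.

Lemma logic_of_eq V E : corresponds V E -> logic_of V = E.
Proof.
intros HE; apply (@corresponds_unique V); [|exact HE].
unfold logic_of; apply epsilon_spec; exists E; exact HE.
Qed.

(** * Identities and generated varieties *)

Lemma eval_hom (A B : algebra) (h : A -> B) (v : nat -> A) f :
  hom h -> h (eval v f) = eval (fun n => h (v n)) f.
Proof.
intros [Hj Hm Hi Hn H0 H1]; induction f; simpl; congruence.
Qed.

Lemma eval_product (I : Type) (A : I -> algebra) (v : nat -> product A) f i :
  eval v f i = eval (fun n => v n i) f.
Proof. induction f; simpl; congruence. Qed.

(** Writes each universally quantified element as an image under the surjection. *)
Ltac pull_back surj :=
  repeat match goal with
  | |- forall x : _, _ =>
      let b := fresh in intros b; destruct (surj b) as [? <-]
  end.

Lemma dhmsh_algebra_image (A B : algebra) (h : A -> B) :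
  hom h -> (forall b, exists a, h a = b) -> dhmsh_algebra A -> dhmsh_algebra B.
Proof.
intros [Hj Hm Hi Hn H0 H1] surj [[[? ? ? ? ? ? ? ?] ? ? ?] ? ? ?].
repeat split; pull_back surj;
  repeat (rewrite <- Hj || rewrite <- Hm || rewrite <- Hi || rewrite <- Hn
          || rewrite <- H0 || rewrite <- H1); f_equal; auto.
Qed.

Lemma dhmsh_algebra_sub (A B : algebra) (h : B -> A) :
  hom h -> (forall x y, h x = h y -> x = y) -> dhmsh_algebra A -> dhmsh_algebra B.
Proof.
intros [Hj Hm Hi Hn H0 H1] inj [[[? ? ? ? ? ? ? ?] ? ? ?] ? ? ?].
repeat split; intros; apply inj;
  repeat (rewrite Hj || rewrite Hm || rewrite Hi || rewrite Hn
          || rewrite H0 || rewrite H1); auto.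
Qed.

Lemma dhmsh_algebra_product (I : Type) (A : I -> algebra) :
  (forall i, dhmsh_algebra (A i)) -> dhmsh_algebra (product A).
Proof.
intros H; repeat split; intros; apply functional_extensionality_dep; intros i;
  destruct (H i) as [[[? ? ? ? ? ? ? ?] ? ? ?] ? ? ?]; simpl; auto.
Qed.

(** The models of a set of formulas form a variety. *)
Lemma variety_models (T : form -> Prop) :
  variety (fun A => dhmsh_algebra A /\ forall d, T d -> valid A d).
Proof.
split.
- intros A B h Hh surj [HA HT]; split; [exact (dhmsh_algebra_image Hh surj HA)|].
  intros d Hd v.
  set (w := fun n => proj1_sig (constructive_indefinite_description _ (surj (v n)))).
  replace v with (fun n => h (w n)).
  + rewrite <- eval_hom, (HT d Hd w) by exact Hh; apply Hh.
  + apply functional_extensionality; intros n; unfold w.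
    destruct constructive_indefinite_description; assumption.
- intros A B h Hh inj [HA HT]; split; [exact (dhmsh_algebra_sub Hh inj HA)|].
  intros d Hd v; apply inj; rewrite eval_hom, (HT d Hd) by exact Hh.
  symmetry; apply Hh.
- intros I A H; split; [apply dhmsh_algebra_product; intros i; apply H|].
  intros d Hd v; apply functional_extensionality_dep; intros i.
  rewrite eval_product; apply H, Hd.
Qed.

Lemma dhmsh_impH_le (A : algebra) (x y : A) :
  dhmsh_algebra A -> imp x (meet x y) = one -> meet x y = x.
Proof.
intros [[HL Hmp _ _] _ _ _] H.
rewrite <- (meet1 HL x) at 2; rewrite <- H, Hmp.
rewrite (meetA HL), <- (meetK HL x zero) at 1.
rewrite (join0 HL); reflexivity.
Qed.

(** Finitely many elements of a nonempty type can be numbered. *)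
Lemma numbering (X : Type) (x0 : X) (l : list X) :
  exists (r : X -> nat) (g : nat -> X), forall x, In x l -> g (r x) = x.
Proof.
induction l as [|y l [r [g Hg]]].
- exists (fun _ => 0), (fun _ => x0); intros x [].
- exists (fun x => if excluded_middle_informative (x = y) then 0 else S (r x)).
  exists (fun n => match n with 0 => y | S m => g m end).
  intros x Hx; destruct (excluded_middle_informative (x = y)) as [-> | Hxy].
  + reflexivity.
  + destruct Hx as [-> | Hx]; [contradiction Hxy; reflexivity | apply Hg, Hx].
Qed.

Section Birkhoff.

Variables (J : Type) (K : J -> algebra) (A : algebra).
Hypothesis HK : forall j, dhmsh_algebra (K j).
Hypothesis HA : dhmsh_algebra A.
Hypothesis HT : forall f, (forall j, valid (K j) f) -> valid A f.

(** All assignments of the elements of [A], seen as variables, in the [K j]. *)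
Definition assignment : Type := {j : J & A -> K j}.

(** The product with one factor [K j] for each assignment into [K j]. *)
Definition power : algebra := product (fun w : assignment => K (projT1 w)).

(** The subalgebra of [power * A] generated by the pairs [(projection at a, a)];
    its elements are the pairs of values of a term with variables in [A]. *)
Inductive generated : power -> A -> Prop :=
| gen_var a : generated (fun w => projT2 w a) a
| gen_join p q a b : generated p a -> generated q b -> generated (join p q) (join a b)
| gen_meet p q a b : generated p a -> generated q b -> generated (meet p q) (meet a b)
| gen_imp p q a b : generated p a -> generated q b -> generated (imp p q) (imp a b)
| gen_neg p a : generated p a -> generated (neg p) (neg a)
| gen_zero : generated zero zero
| gen_one : generated one one.

(** A generated pair consists of the values of one formula, once the finitely
    many elements of [A] involved are numbered. *)
Lemma generated_form p a :
  generated p a ->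
  exists l : list A, forall (r : A -> nat) (g : nat -> A),
    (forall x, In x l -> g (r x) = x) ->
    exists f, eval g f = a /\
      forall j (v : nat -> K j), eval v f = p (existT _ j (fun x => v (r x))).
Proof.
assert (binary : forall (P Q R : (A -> nat) -> (nat -> A) -> Prop),
  (forall r g, P r g -> Q r g -> R r g) ->
  (exists l : list A, forall r g, (forall x, In x l -> g (r x) = x) -> P r g) ->
  (exists l : list A, forall r g, (forall x, In x l -> g (r x) = x) -> Q r g) ->
  exists l : list A, forall r g, (forall x, In x l -> g (r x) = x) -> R r g).
{ intros P Q R HR [l Hl] [l' Hl']; exists (l ++ l'); intros r g H.
  apply HR; [apply Hl | apply Hl']; intros x Hx; apply H, in_or_app; auto. }
intros H; induction H as [a|p q a b _ IHp _ IHq|p q a b _ IHp _ IHq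
                         |p q a b _ IHp _ IHq|p a _ [l Hl]| |].
- exists [a]; intros r g H; exists (Var (r a)); split; [apply H; left|]; reflexivity.
- revert IHp IHq; apply binary; intros r g [f [Hf Hfv]] [f' [Hf' Hfv']].
  exists (Or f f'); split; [simpl; congruence|].
  intros j v; simpl; rewrite Hfv, Hfv'; reflexivity.
- revert IHp IHq; apply binary; intros r g [f [Hf Hfv]] [f' [Hf' Hfv']].
  exists (And f f'); split; [simpl; congruence|].
  intros j v; simpl; rewrite Hfv, Hfv'; reflexivity.
- revert IHp IHq; apply binary; intros r g [f [Hf Hfv]] [f' [Hf' Hfv']].
  exists (Imp f f'); split; [simpl; congruence|].
  intros j v; simpl; rewrite Hfv, Hfv'; reflexivity.
- exists l; intros r g H; destruct (Hl r g H) as [f [Hf Hfv]].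
  exists (Neg f); split; [simpl; congruence|].
  intros j v; simpl; rewrite Hfv; reflexivity.
- exists []; intros r g _; exists Bot; split; reflexivity.
- exists []; intros r g _; exists Top; split; reflexivity.
Qed.

Lemma impH_eq1 (B : algebra) (v : nat -> B) f f' :
  dhmsh_algebra B -> eval v f = eval v f' -> eval v (ImpH f f') = one.
Proof.
intros [[HL Hmp _ Hrefl] _ _ _] H; simpl; rewrite <- H.
replace (meet (eval v f) (eval v f)) with (eval v f); [apply Hrefl|].
rewrite <- (Hmp (eval v f) (eval v f)), Hrefl; symmetry; apply (meet1 HL).
Qed.

(** This is where the identities of the [K j] are used in [A]. *)
Lemma generated_functional p a b : generated p a -> generated p b -> a = b.
Proof.
intros Ha Hb.
apply generated_form in Ha; apply generated_form in Hb.
destruct Ha as [l Hl], Hb as [l' Hl'].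
destruct (numbering (@zero A) (l ++ l')) as [r [g Hrg]].
destruct (Hl r g) as [f [<- Hf]]; [intros; apply Hrg, in_or_app; auto|].
destruct (Hl' r g) as [f' [<- Hf']]; [intros; apply Hrg, in_or_app; auto|].
assert (Hle : meet (eval g f) (eval g f') = eval g f).
{ apply (dhmsh_impH_le HA), (@HT (ImpH f f')).
  intros j v; apply (impH_eq1 (HK j)); rewrite Hf, Hf'; reflexivity. }
assert (Hge : meet (eval g f') (eval g f) = eval g f').
{ apply (dhmsh_impH_le HA), (@HT (ImpH f' f)).
  intros j v; apply (impH_eq1 (HK j)); rewrite Hf, Hf'; reflexivity. }
rewrite (meetC (sh_lattice (dhmsh_sh HA))) in Hle; congruence.
Qed.

(** [generated] as an algebra; it embeds into [power] by
    [generated_functional] and maps onto [A]. *)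
Definition graph : algebra := {|
  carrier := {pa : power * A | generated (fst pa) (snd pa)};
  join := fun x y => exist _ (join (fst (proj1_sig x)) (fst (proj1_sig y)),
                              join (snd (proj1_sig x)) (snd (proj1_sig y)))
                       (gen_join (proj2_sig x) (proj2_sig y));
  meet := fun x y => exist _ (meet (fst (proj1_sig x)) (fst (proj1_sig y)),
                              meet (snd (proj1_sig x)) (snd (proj1_sig y)))
                       (gen_meet (proj2_sig x) (proj2_sig y));
  imp  := fun x y => exist _ (imp (fst (proj1_sig x)) (fst (proj1_sig y)),
                              imp (snd (proj1_sig x)) (snd (proj1_sig y)))
                       (gen_imp (proj2_sig x) (proj2_sig y));
  neg  := fun x => exist _ (neg (fst (proj1_sig x)), neg (snd (proj1_sig x)))
                     (gen_neg (proj2_sig x));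
  zero := exist _ (zero, zero) gen_zero;
  one  := exist _ (one, one) gen_one
|}.

Lemma variety_of_models (W : algebra -> Prop) :
  variety W -> (forall j, W (K j)) -> W A.
Proof.
intros [WH WS WP] WK.
apply (WH graph A (fun x => snd (proj1_sig x))); [split; reflexivity | |].
- intros a; exists (exist _ (_, a) (gen_var a)); reflexivity.
- apply (WS power graph (fun x => fst (proj1_sig x))); [split; reflexivity | |].
  + intros [[p a] Ha] [[q b] Hb]; simpl in *; intros ->.
    apply subset_eq_compat; f_equal; exact (generated_functional Ha Hb).
  + apply WP; intros w; apply WK.
Qed.

End Birkhoff.

(** Birkhoff's theorem, for a set of algebras [K j]. *)
Lemma generated_of_models (J : Type) (K : J -> algebra) (A : algebra) :
  (forall j, dhmsh_algebra (K j)) -> dhmsh_algebra A ->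
  (forall f, (forall j, valid (K j) f) -> valid A f) ->
  generated_variety (fun B => exists j, B = K j) A.
Proof.
intros HK HA HT W HW HWK; apply (@variety_of_models J K A HK HA HT W HW).
intros j; apply HWK; exists j; reflexivity.
Qed.

(** A logic sound for the algebras [K j] and having all their valid formulas as
    axioms corresponds to the variety which they generate. *)
Lemma logic_of_generated (J : Type) (K : J -> algebra) :
  (forall j, dhmsh_algebra (K j)) ->
  let Ax := fun f => dhmsh_axiom f \/ forall j, valid (K j) f in
  (forall j f, is_theorem (hilbert Ax) f -> valid (K j) f) ->
  logic_of (generated_variety (fun B => exists j, B = K j)) = hilbert Ax.
Proof.
intros HK Ax sound; apply logic_of_eq; split.
- exists (fun f => forall j, valid (K j) f), dhmsh_axiom; split; reflexivity.
- intros A; split.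
  + intros HA; apply HA; [apply variety_models|].
    intros B [j ->]; split; [apply HK|]; intros d; apply sound.
  + intros [HA HT]; apply generated_of_models; [exact HK | exact HA |].
    intros f Hf; apply HT, hilbert_ax; right; exact Hf.
Qed.

(** * The two-element algebras *)

Definition two (j : bool) : algebra := if j then two_e else two_bar_e.

Lemma dhmsh_two j : dhmsh_algebra (two j).
Proof.
destruct j; repeat split; simpl; intros;
  repeat match goal with b : bool |- _ => destruct b end; reflexivity.
Qed.

Ltac eval_cases :=
  repeat match goal with |- context [@eval ?A ?v ?a] => destruct (@eval A v a) end.

Lemma axiom_two j f : dhmsh_axiom f -> valid (two j) f.
Proof.
intros H v; destruct j; destruct H; simpl in *;
  eval_cases; reflexivity.
Qed.

Lemma eval_subst (A : algebra) (v : nat -> A) s f :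
  eval v (subst s f) = eval (fun n => eval v (s n)) f.
Proof. induction f; simpl; congruence. Qed.

Lemma sound_two j (Ax : form -> Prop) :
  (forall f, Ax f -> valid (two j) f) ->
  forall f, is_theorem (hilbert Ax) f -> valid (two j) f.
Proof.
unfold is_theorem; intros HAx f H.
induction H as [s a Ha|a []|a c _ IHa _ IHc|a c _ IHac]; intros v.
- rewrite eval_subst; apply HAx, Ha.
- specialize (IHa v); specialize (IHc v); revert IHa IHc.
  destruct j; simpl; eval_cases; simpl; congruence.
- specialize (IHac v); revert IHac.
  destruct j; simpl; eval_cases; simpl; congruence.
Qed.

(** The axioms of DHMSH together with all formulas valid in some of the
    two-element algebras, those [two (i j)]. *)
Definition axioms_of (J : Type) (i : J -> bool) (f : form) : Prop :=
  dhmsh_axiom f \/ forall j, valid (two (i j)) f.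

Lemma logic_of_two (J : Type) (i : J -> bool) (C : algebra -> Prop) :
  (forall B, C B <-> exists j, B = two (i j)) ->
  logic_of (generated_variety C) = hilbert (axioms_of i).
Proof.
intros HC.
replace C with (fun B => exists j, B = two (i j)).
- apply (@logic_of_generated J (fun j => two (i j))).
  + intros j; apply dhmsh_two.
  + intros j; apply sound_two; intros f [Hf|Hf]; [apply axiom_two, Hf | apply Hf].
- apply functional_extensionality; intros B; apply propositional_extensionality.
  symmetry; apply HC.
Qed.

Lemma L_two_e_eq : L_two_e = hilbert (axioms_of (fun _ : unit => true)).
Proof.
apply logic_of_two; intros B; split.
- intros ->; exists tt; reflexivity.
- intros [_ ->]; reflexivity.
Qed.

Lemma L_two_e_two_bar_e_eq :
  L_two_e_two_bar_e = hilbert (axioms_of (fun j : bool => j)).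
Proof.
apply logic_of_two; intros B; split.
- intros [-> | ->]; [exists true | exists false]; reflexivity.
- intros [[|] ->]; [left | right]; reflexivity.
Qed.

Lemma valid_guarded f :
  valid two_e f -> forall j, valid (two j) (ImpH (Imp Bot Top) f).
Proof.
intros Hf [|] v; simpl.
- apply Hf.
- reflexivity.
Qed.

Theorem corollary7p2 :
  axiomatic_extension L_two_e_two_bar_e (fun a => a = Imp Bot Top) L_two_e.
Proof.
exists (axioms_of (fun j : bool => j)); split; [apply L_two_e_two_bar_e_eq|].
rewrite L_two_e_eq; apply hilbert_eq.
- intros s f [Hf|Hf]; [apply hilbert_axiom; left; left; exact Hf|].
  apply (@hilbert_SMP _ _ (Imp Bot Top)).
  + apply hilbert_ax; right; reflexivity.
  + apply (@hilbert_axiom _ _ s (ImpH (Imp Bot Top) f)).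
    left; right; apply valid_guarded, (Hf tt).
- intros s f [[Hf|Hf]| ->]; apply hilbert_axiom.
  + left; exact Hf.
  + right; intros _; apply (Hf true).
  + right; intros _ v; reflexivity.
Qed.
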